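(* Consider the interconnected system $\dot x_i = f_i(x)+g_i(x)u_i$, $i=1,\dots,N$, with safety function $h$, safety set $\mathcal{C}=\{x: h(x)\ge 0\}$, margin $c>0$ and $\mathcal{C}_c=\{x: h(x)\ge c\}$. Suppose the system experiences multiple attack cycles $[t_{0,1},t_{f,1}],[t_{0,2},t_{f,2}],\dots$ with $t_{0,1}=t_0$, where each subsystem is compromised at most once per attack cycle. Assume $x(t_0)\in\mathcal{C}_c$ and that the nominal policy $\hat u=(\hat u_1,\dots,\hat u_N)$ satisfies the nominal-policy assumption stated in the context, with constant $\tau>0$. Let each subsystem $S_i$ employ the resilient architecture $M(S_i)$, with recovery time $t(M(S_i))$. Let $\rho_1,\dots,\rho_N<0$ be scalars such that for each $i$ $$\frac{\partial h}{\partial x_i}(x)\, g_i(x)\,(u_i-\hat u_i(x))\ \ge\ \rho_i\qquad \text{for all } x\in\mathcal{C}\setminus\mathcal{C}_c \text{ and all } u_i\in\mathcal{U}_i ,$$ and suppose $$\sum_{i=1}^N \rho_i\, t(M(S_i)) + c \ \ge\ 0.$$ If $t_{0,k+1}-t_{f,k}\ge\tau$ for all $k=1,2,\dots$, then the system remains safe for all time, i.e. $x(t)\in\mathcal{C}$ for all $t\ge t_0$.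
   Context: System: there are $N$ subsystems $\mathcal{S}=\{S_1,\dots,S_N\}$ with states $x_i\in\mathbb{R}^{n_i}$, $x=[x_1^T\cdots x_N^T]^T\in\mathbb{R}^n$, $n=\sum_i n_i$, and dynamics $\dot x_i=f_i(x)+g_i(x)u_i$, where $f_i:\mathbb{R}^n\to\mathbb{R}^{n_i}$ and $g_i:\mathbb{R}^n\to\mathbb{R}^{n_i\times r_i}$ are Lipschitz continuous. Inputs satisfy $u_i\in\mathcal{U}_i=\prod_{j=1}^{r_i}[\underline u_{i,j},\overline u_{i,j}]$ with $\underline u_{i,j}<\overline u_{i,j}$. Inputs are measurable functions of time and trajectories are (locally) absolutely continuous solutions of the ODE, defined for all $t\ge t_0$. The nominal control policy of $S_i$ is a map $\hat u_i=\mu_i:\mathbb{R}^n\to\mathcal{U}_i$. Safety: $h:\mathbb{R}^n\to\mathbb{R}$ is continuously differentiable; $\frac{\partial h}{\partial x_i}$ is the row vector of partial derivatives with respect to the components of $x_i$; $\mathcal{C}=\{x:h(x)\ge 0\}$. The system is safe at time $t$ if $x(t)\in\mathcal{C}$. Nominal-policy assumption: with $\alpha$ an extended class-$\mathcal{K}$ function (continuous, strictly increasing, $\alpha(0)=0$) and a constant $\tau>0$, $$\sum_{i=1}^N \frac{\partial h}{\partial x_i}\big(f_i(x)+g_i(x)\hat u_i(x)\big)\ge -\alpha(h(x)-c)\quad\forall x\in\mathcal{C}_c,$$ $$\sum_{i=1}^N \frac{\partial h}{\partial x_i}\big(f_i(x)+g_i(x)\hat u_i(x)\big)\ge \frac{c}{\tau}\quad\forall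 x\in\mathcal{C}\setminus\mathcal{C}_c.$$ Architectures and attacks: there is a finite set $\mathcal{A}=\{A_1,\dots,A_J\}$ of resilient architectures, each with a guaranteed recovery time $t(A_j)\ge 0$, and an assignment map $M:\mathcal{S}\to\mathcal{A}$. In each attack cycle $[t_{0,k},t_{f,k}]$, each subsystem $S_i$ may be compromised at most once, on a time interval contained in $[t_{0,k},t_{f,k}]$ whose length is at most $t(M(S_i))$; these intervals may have arbitrary order and overlap. While $S_i$ is compromised, $u_i(t)$ is an arbitrary corrupted input in $\mathcal{U}_i$; whenever $S_i$ is not compromised (in particular outside the attack cycles), $u_i(t)=\hat u_i(x(t))$. By time $t_{f,k}$ all subsystems compromised in the $k$-th cycle have recovered. *)

(* Defs.v *)
(* MathComp-Analysis *)
From HB Require Import structures.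
From mathcomp Require Export all_boot all_order all_algebra.
From mathcomp Require Export all_classical all_reals all_analysis.
From mathcomp Require Export measurable_realfun.

Set Implicit Arguments.
Unset Strict Implicit.
Unset Printing Implicit Defensive.

Export Order.TTheory GRing.Theory Num.Theory.
Export numFieldNormedType.Exports.

#[export] Set Implicit Arguments.
#[export] Unset Strict Implicit.
#[export] Unset Printing Implicit Defensive.

Local Open Scope classical_set_scope.
Local Open Scope ring_scope.

Section Calculus.
Context {R : realType}.

Definition gradient (m : nat) (h : 'cV[R]_m -> R) (x : 'cV[R]_m) : 'rV[R]_m :=
  \row_j 'D_(delta_mx j 0) h x.

Definition continuously_differentiable (m : nat) (h : 'cV[R]_m -> R) : Prop :=
  (forall x, differentiable h x) /\ continuous (gradient h).

Definition extended_class_K (alpha : R -> R) : Prop :=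
  [/\ continuous alpha,
      {homo alpha : s t / s < t} & alpha 0 = 0].

(* Measurability of the domain side is with respect to the completed
   (Lebesgue) sigma-algebra, not the Borel one. *)
Definition lebesgue_measurable_fun (D : set R) (f : R -> R) : Prop :=
  measurable_fun
    (D : set (g_sigma_algebraType
                (completed_algebra_gen (@lebesgue_measure R))))
    (f : _ -> measurableTypeR R).

Definition abs_continuous (V : normedModType R) (a b : R) (F : R -> V) : Prop :=
  forall e : R, 0 < e -> exists2 d : R, 0 < d &
    forall (m : nat) (l r : 'I_m -> R),
      (forall k, [/\ a <= l k, l k <= r k & r k <= b]) ->
      trivIset [set: 'I_m] (fun k => `]l k, r k[%classic) ->
      \sum_k (r k - l k) < d ->
      \sum_k `|F (r k) - F (l k)| < e.

End Calculus.

Section Interconnection.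
Context {R : realType} {N : nat} {n r : 'I_N -> nat}.

(* The global state is the stacked column \mxcol_i x_i, and the state x_i of
   the i-th subsystem is submxcol x i. *)
Local Notation state := 'cV[R]_(\sum_i n i).

Definition partial_block (h : state -> R) (x : state) (i : 'I_N) :
  'rV[R]_(n i) := submxrow (gradient h x) i.

Definition superlevel (h : state -> R) (a : R) : set state :=
  [set x | a <= h x].

Definition safe_set (h : state -> R) : set state := superlevel h 0.

Definition input_box (ulo uhi : forall i, 'cV[R]_(r i)) (i : 'I_N) :
  set 'cV[R]_(r i) :=
  [set v | forall j, ulo i j 0 <= v j 0 <= uhi i j 0].
Arguments input_box ulo uhi i : clear implicits.

Definition nominal_hdot
    (f : forall i, state -> 'cV[R]_(n i))
    (g : forall i, state -> 'M[R]_(n i, r i))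
    (h : state -> R) (mu : forall i, state -> 'cV[R]_(r i)) (x : state) : R :=
  \sum_i (partial_block h x i *m (f i x + g i x *m mu i x)) 0 0.

Definition nominal_policy_assumption
    (f : forall i, state -> 'cV[R]_(n i))
    (g : forall i, state -> 'M[R]_(n i, r i))
    (h : state -> R) (mu : forall i, state -> 'cV[R]_(r i))
    (alpha : R -> R) (c tau : R) : Prop :=
  (forall x, superlevel h c x -> - alpha (h x - c) <= nominal_hdot f g h mu x)
  /\
  (forall x, (safe_set h `\` superlevel h c) x ->
     c / tau <= nominal_hdot f g h mu x).

(* u i t is the input of the i-th subsystem at time t; the values of x and u
   before t0 are irrelevant. *)
Definition trajectory
    (f : forall i, state -> 'cV[R]_(n i))
    (g : forall i, state -> 'M[R]_(n i, r i))
    (ulo uhi : forall i, 'cV[R]_(r i)) (t0 : R)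
    (x : R -> state) (u : forall i, R -> 'cV[R]_(r i)) : Prop :=
  [/\ forall i j, lebesgue_measurable_fun `[t0, +oo[ (fun t => u i t j 0),
      forall i t, t0 <= t -> input_box ulo uhi i (u i t),
      forall b, t0 <= b -> abs_continuous t0 b x &
      {ae lebesgue_measure, forall t, t0 < t -> forall i,
        is_derive t 1 (fun s => submxcol (x s) i)
          (f i (x t) + g i (x t) *m u i t)}].

(* Cycle k is [ts k, tf k] and I k i is the time interval, with either kind of
   endpoint, on which subsystem i is compromised during cycle k; I k i is empty
   when i is not compromised in that cycle. *)
Definition compromised (I : nat -> 'I_N -> interval R) (i : 'I_N) (t : R) :
  Prop := exists k, t \in I k i.

Definition attack_schedule (trec : 'I_N -> R) (ts tf : nat -> R)
    (I : nat -> 'I_N -> interval R) : Prop :=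
  [/\ forall k, ts k <= tf k,
      forall k i, [set` I k i] `<=` `[ts k, tf k] &
      forall k i, (lebesgue_measure [set` I k i] <= (trec i)%:E)%E].

End Interconnection.

Arguments input_box {R N r} ulo uhi i.

(* Main.v *)
(* The scalar phi = h o x is absolutely continuous, because h is Lipschitz on the
   segments joining points of the compact curve x([t0, b]).  Where 0 <= phi < c,
   its derivative is almost everywhere at least
     c / tau + sum_i rho_i 1_{J_i},
   with J_i the attack interval of subsystem i in the current cycle.  If s is the
   last time at which phi = c before t, and phi >= 0 on [s, t], then integrating gives
     phi(t) >= c + (c / tau) (t - s) + sum_i rho_i |J_i /\ [s, t]|,
   which the budget keeps >= (c / tau) (t - s) > 0: phi cannot reach 0.  At the end
   of the cycle either s lies before tf, so that t - s >= tau, or no J_i meets [s, t];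
   both give phi >= c, and the next cycle starts in C_c again.
   The integral inequality is the monotonicity of an absolutely continuous function
   whose derivative is almost everywhere nonnegative, proved by covering the
   exceptional null set by a small open set and using Cousin's lemma. *)
Require Import Defs.
From mathcomp Require Import ring lra.

Local Open Scope classical_set_scope.
Local Open Scope ring_scope.

(** * Crossing times and monotonicity on the real line *)

Section RealLine.
Context {R : realType}.
Implicit Types (a b c t u v : R) (F : R -> R).

(* Cousin's lemma as an induction principle: the intervals [u, v] are the cells
   of a tagged partition, t is the tag and d the gauge. *)
Lemma cousin_ind a b (P : R -> Prop) : a <= b ->
  (forall t, a <= t <= b -> exists2 d : R, 0 < d &
     forall u v, a <= u -> u <= t -> t <= v -> v <= b ->
       t - u < d -> v - t < d -> P u -> P v) ->
  P a -> P b.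
Proof.
move=> ab gauge Pa.
pose S := [set t | a <= t <= b /\ P t].
have Sa : S a by split=> //; rewrite lexx.
have ubS : ubound S b by move=> t [/andP[]].
have supS : has_sup S by split; [exists a | exists b].
have as_ : a <= sup S by apply: ub_le_sup => //; exists b.
have sb : sup S <= b by apply: ge_sup => //; exists a.
have [|d d0 gd] := gauge (sup S); first by rewrite as_.
have [u [/andP[au ub] Pu] su] := sup_adherent d0 supS.
have us : u <= sup S by apply: ub_le_sup; [exists b|split=> //; rewrite au].
(* The cell tagged at [sup S] ends strictly beyond [sup S] unless it is cut off at [b]; since [P v]
   holds, only [v = b] remains. *)
pose v := Num.min b (sup S + d / 2).
have sv : sup S <= v by rewrite le_min sb/=; lra.
have vb : v <= b by rewrite ge_min lexx.
have vs : v <= sup S + d / 2 by rewrite ge_min lexx orbT.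
have Pv : P v by apply: (gd u v) => //; lra.
have vS : v <= sup S.
  apply: ub_le_sup; first by exists b.
  by split=> //; rewrite vb andbT; lra.
have : v = b; last by move=> <-.
move: vS; rewrite /v; case: (lerP b (sup S + d / 2)) => //; lra.
Qed.

Lemma within_itv_continuousP (V : normedModType R) a b (f : R -> V) :
  {within `[a, b], continuous f} <->
  forall t e, a <= t <= b -> 0 < e -> exists2 d : R, 0 < d &
    forall s, a <= s <= b -> `|s - t| < d -> `|f s - f t| < e.
Proof.
rewrite subspace_continuousP; split=> [cf t e tab e0|cf t tab].
  have /cvgrPdist_lt/(_ _ e0) := cf t tab.
  rewrite /prop_near1/within/= => /nbhs_ballP[d /= d0 dP].
  exists d => // s sab std; rewrite distrC; apply: dP => //=.
  by rewrite /ball/= distrC.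
apply/cvgrPdist_lt => e e0; have [d d0 dP] := cf t e tab e0.
rewrite /prop_near1/within/=; apply/nbhs_ballP; exists d => //= s st sab.
by rewrite distrC; apply: dP => //; rewrite distrC.
Qed.

(** The crossing time is the supremum of the times in [a, b] where [F] is at least [c]; continuity
    excludes both [F s < c] and [F s > c] there. *)
Lemma last_ge a b F c : a <= b ->
  {within `[a, b], continuous F} -> c <= F a -> F b < c ->
  exists s, [/\ a <= s, s < b, F s = c & forall t, s < t -> t <= b -> F t < c].
Proof.
move=> ab /within_itv_continuousP cF ca cb.
pose S := [set t | a <= t <= b /\ c <= F t].
have Sa : S a by split=> //; rewrite lexx.
have ubS : ubound S b by move=> t [/andP[]].
have supS : has_sup S by split; [exists a | exists b].
have as_ : a <= sup S by apply: ub_le_sup => //; exists b.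
have sb : sup S <= b by apply: ge_sup => //; exists a.
have sab : a <= sup S <= b by rewrite as_.
have Fs : c <= F (sup S).
  rewrite leNgt; apply/negP => Fc.
  have [|d d0 dP] := cF (sup S) (c - F (sup S)) sab; first by rewrite subr_gt0.
  have [u [uab Fu] su] := sup_adherent d0 supS.
  have us : u <= sup S by apply: ub_le_sup; [exists b|split].
  have := dP u uab; rewrite !ltr_norml; lra.
have sb' : sup S < b.
  by rewrite lt_neqAle sb andbT; apply/eqP => E; move: Fs; rewrite E; lra.
have after t : sup S < t -> t <= b -> F t < c.
  move=> st tb; rewrite ltNge; apply/negP => Ft.
  suff : t <= sup S by lra.
  by apply: ub_le_sup; [exists b|split=> //; lra].
exists (sup S); split => //; apply/eqP; rewrite eq_le Fs andbT leNgt.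
apply/negP => cF'.
have [|d d0 dP] := cF (sup S) (F (sup S) - c) sab; first by rewrite subr_gt0.
pose t := Num.min b (sup S + d / 2).
have st : sup S < t by rewrite lt_min sb'/=; lra.
have tb : t <= b by rewrite ge_min lexx.
have ts : t <= sup S + d / 2 by rewrite ge_min lexx orbT.
have := dP t; have := after t st tb; rewrite !ltr_norml; lra.
Qed.

(** Reversing both time and sign turns a first crossing into a last one. *)
Lemma first_le a b F c : a <= b ->
  {within `[a, b], continuous F} -> c < F a -> F b <= c ->
  exists s, [/\ a < s, s <= b, F s = c & forall t, a <= t -> t < s -> c < F t].
Proof.
move=> ab /within_itv_continuousP cF ca cb.
have [||||s [sa sb Fs after]] := @last_ge (- b) (- a) (fun t => - F (- t)) (- c).
- by rewrite lerN2.
- apply/within_itv_continuousP => t e tab e0.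
  have [|d d0 dP] := cF (- t) e _ e0; first lra.
  exists d => // s sab std; rewrite -opprD normrN; apply: dP; first lra.
  by rewrite -opprD normrN.
- by rewrite opprK lerN2.
- by rewrite opprK ltrN2.
exists (- s); split; [lra|lra|lra|move=> t at_ ts].
by have := after (- t); rewrite opprK; lra.
Qed.

Lemma negligible_open_cover (N : set R) (e : R) :
  (@lebesgue_measure R).-negligible N -> 0 < e ->
  exists U : set R, [/\ open U, N `<=` U & (lebesgue_measure U < e%:E)%E].
Proof.
move=> [A [mA A0 NA]] e0.
have [|U [oU AU UA]] := lebesgue_regularity_outer mA _ e0.
  by rewrite [X in (X < _)%E]A0 ltry.
exists U; split => //; first exact: subset_trans AU.
apply: le_lt_trans UA.
have mU : measurable U by exact: open_measurable.
rewrite -{1}(setDUK AU).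
rewrite (le_trans (measureU2 _ _ _))//=; first exact: measurableD.
by rewrite [X in (X + _)%E]A0 add0e.
Qed.

(** One-sided straddle lemma: near [t] the difference quotients exceed [- e] on either side, and the
    estimates on [u, t] and [t, v] add up. *)
Lemma is_derive_ge0_straddle F t d e : is_derive t 1 F d -> 0 <= d -> 0 < e ->
  exists2 h : R, 0 < h & forall u v, u <= t -> t <= v ->
    t - u < h -> v - t < h -> F u - e * (v - u) <= F v.
Proof.
move=> [/cvg_ex[/= l Fl]]; rewrite /derive => lim_d d0 e0.
have {lim_d} ld : l = d by rewrite -lim_d; apply/esym/cvg_lim.
move: Fl; rewrite {l}ld => /cvgrPdist_lt/(_ _ e0).
rewrite /dnbhs/prop_near1/within/= => /nbhs_ballP[h /= h0 hP].
have {}hP s : s != 0 -> `|s| < h -> - e < s^-1 * (F (s + t) - F t).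
  move=> s0 sh; have /= := hP s _ s0; rewrite /ball/= sub0r normrN => /(_ sh).
  rewrite [s%:A]mulr1 /GRing.scale/= ltr_norml; lra.
exists h => // u v ut tv uh vh.
have tv' : F t - e * (v - t) <= F v.
  rewrite le_eqVlt in tv; case/predU1P: tv => [->|tv]; first by rewrite subrr mulr0 subr0.
  have s0 : 0 < v - t by rewrite subr_gt0.
  have := hP (v - t) (lt0r_neq0 s0); rewrite gtr0_norm// => /(_ vh).
  by rewrite ltr_pdivlMl// subrK; lra.
have ut' : F u - e * (t - u) <= F t.
  rewrite le_eqVlt in ut; case/predU1P: ut => [->|ut]; first by rewrite subrr mulr0 subr0.
  have s0 : u - t < 0 by rewrite subr_lt0.
  have := hP (u - t) (ltr0_neq0 s0); rewrite ltr0_norm// opprB => /(_ uh).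
  by rewrite ltr_ndivlMl// subrK; lra.
have : e * (v - u) = e * (v - t) + e * (t - u) by ring.
lra.
Qed.

Lemma abs_continuous_ae_derive_ge0 a b F : a <= b ->
  abs_continuous a b F ->
  {ae lebesgue_measure, forall t, a < t < b ->
    exists2 d : R, 0 <= d & is_derive t 1 F d} ->
  F a <= F b.
Proof.
move=> ab acF aeF.
(* The endpoints, where no derivative is assumed, join the exceptional set, which stays null. *)
pose N := (~` [set t | a < t < b -> exists2 d : R, 0 <= d & is_derive t 1 F d])
  `|` ([set a] `|` [set b]).
have negN : (@lebesgue_measure R).-negligible N.
  apply: negligibleU; first exact: aeF.
  by apply: negligibleU; apply/negligibleP => //; exact: lebesgue_measure_set1.
have notN t : a <= t <= b -> ~ N t -> exists2 d : R, 0 <= d & is_derive t 1 F d.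
  move=> tab Nt; have [/contrapT+ /not_orP[/= ta tb]] := (not_orP _ _).1 Nt.
  by apply; rewrite !lt_neqAle; move: tab => /andP[-> ->]; rewrite !andbT;
    apply/andP; split; apply/eqP => // /esym.
apply/ler_addgt0Pr => e0 e0_gt0.
(* The cells tagged outside [N] will cost at most [e * (b - a)] altogether, the others at most
   [e]. *)
have [e e_gt0 eE] : exists2 e, 0 < e & e0 = e * (b - a) + e.
  exists (e0 / (b - a + 1)); first by rewrite divr_gt0// ltr_wpDl// subr_ge0.
  field; rewrite gt_eqF//; lra.
have [d d0 dP] := acF e e_gt0.
have [U [oU NU Ud]] := negligible_open_cover negN d0.
(* Measuring [U] only up to [t] makes the length bound inductive: a new cell ]u, v[ inside [U] is
   disjoint from the part of [U] before [u]. *)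
pose mU t := lebesgue_measure (U `&` `[a, t[).
(* The cells with tag in N lie in U; they are collected in l, r. *)
pose Q t := exists (m : nat) (l r : 'I_m -> R),
  [/\ forall k, [/\ a <= l k, l k <= r k & r k <= t],
      trivIset [set: 'I_m] (fun k => `]l k, r k[%classic),
      ((\sum_k (r k - l k))%:E <= mU t)%E &
      F a - e * (t - a) - \sum_k `|F (r k) - F (l k)| <= F t].
have measU : measurable U by exact: open_measurable.
have mUi t : measurable (U `&` `[a, t[) by exact: measurableI.
have : Q b.
  apply: (@cousin_ind a b) => //; last first.
    exists 0, (fun=> 0), (fun=> 0); rewrite !big_ord0; split => //.
    - by case.
    - by case.
    - lra.
  (* At a tag in [N] the gauge keeps the cell inside [U], and the cell joins the collection at index
     [ord0]; elsewhere the straddle estimate applies and the collection is unchanged. *)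
  move=> t tab; have [Nt|Nt] := pselect (N t).
    have /nbhs_ballP[h /= h0 hP] : nbhs t U.
      by apply: open_nbhs_nbhs; split=> //; exact: NU.
    exists h => // u v au ut tv vb uh vh [m [l [r [lr tlr slr Fu]]]].
    pose l' (i : 'I_m.+1) := if unlift ord0 i is Some j then l j else u.
    pose r' (i : 'I_m.+1) := if unlift ord0 i is Some j then r j else v.
    exists m.+1, l', r'; split.
    - move=> k; rewrite /l' /r'; case: unliftP => [j _|_]; last by split; lra.
      by have [? ? ?] := lr j; split; lra.
    - move=> i j _ _ [s []]; rewrite /l' /r' /= !in_itv/=.
      case: unliftP => [i' ->|->]; case: unliftP => [j' ->|->] //.
      + move=> ilr jlr; congr lift; apply: tlr => //.
        by exists s; split => /=; rewrite in_itv.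
      + by have [? ? ?] := lr i'; move=> /andP[? ?] /andP[? ?]; exfalso; lra.
      + by have [? ? ?] := lr j'; move=> /andP[? ?] /andP[? ?]; exfalso; lra.
    - rewrite big_ord_recl /l' /r' unlift_none.
      under eq_bigr do rewrite liftK.
      rewrite EFinD addeC.
      have uvE : ((v - u)%:E = lebesgue_measure `]u, v[%classic)%E.
        rewrite lebesgue_measure_itv/= lte_fin; case: ltP => [//|vu].
        by congr EFin; lra.
      rewrite uvE; apply: le_trans (leeD2r _ slr) _.
      have uv0 : (U `&` `[a, u[) `&` `]u, v[ = set0.
        rewrite -subset0 => s [[_]] /=; rewrite !in_itv/= => /andP[? ?] /andP[? ?]; lra.
      rewrite -[leLHS](measureU (@lebesgue_measure R) (mUi u) (measurable_itv _) uv0).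
      apply: le_measure; rewrite ?inE.
      - by apply: measurableU; [exact: mUi|exact: measurable_itv].
      - exact: mUi.
      move=> s [[Us su]|su].
        by split=> //; move: su; rewrite /= !in_itv/=; lra.
      have /andP[us sv] : u < s < v by move: su; rewrite /= in_itv.
      split; last by rewrite /= in_itv/=; lra.
      by apply: hP; rewrite /ball/= ltr_norml; lra.
    - rewrite big_ord_recl /l' /r' unlift_none.
      under eq_bigr do rewrite liftK.
      rewrite /=.
      have : e * (v - a) = e * (u - a) + e * (v - u) by ring.
      have : 0 <= e * (v - u) by apply: mulr_ge0; [exact: ltW|lra].
      have := ler_norm (- (F v - F u)); rewrite normrN; lra.
  have [D D0 FD] := notN t tab Nt.
  have [h h0 hP] := is_derive_ge0_straddle FD D0 e_gt0.
  exists h => // u v au ut tv vb uh vh [m [l [r [lr tlr slr Fu]]]].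
  exists m, l, r; split => //.
  - by move=> k; have [? ? ?] := lr k; split; lra.
  - apply: le_trans slr _; apply: le_measure; rewrite ?inE; [exact: mUi|exact: mUi|].
    by move=> s [Us su]; split => //; move: su; rewrite /= !in_itv/=; lra.
  - have := hP u v ut tv uh vh.
    have : e * (v - a) = e * (u - a) + e * (v - u) by ring.
    lra.
move=> [m [l [r [lr tlr slr Fb]]]].
suff : \sum_k `|F (r k) - F (l k)| < e by lra.
apply: dP => //.
rewrite -lte_fin; apply: le_lt_trans slr _; apply: le_lt_trans Ud.
by apply: le_measure; rewrite ?inE; [exact: mUi| |exact: subIsetl].
Qed.

End RealLine.

(** * Absolute continuity *)

Section AC.
Context {R : realType}.
Implicit Types (a b t u v : R).

Lemma abs_continuous_subitv (V : normedModType R) a b a' b' (F : R -> V) :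
  a <= a' -> b' <= b -> abs_continuous a b F -> abs_continuous a' b' F.
Proof.
move=> aa bb acF e e0; have [d d0 dP] := acF e e0; exists d => // m l r lr.
by apply: dP => k; have [? ? ?] := lr k; split=> //; lra.
Qed.

Lemma abs_continuous_within (V : normedModType R) a b (F : R -> V) :
  abs_continuous a b F -> {within `[a, b], continuous F}.
Proof.
move=> acF; apply/within_itv_continuousP => t e tab e0.
have [d d0 dP] := acF e e0; exists d => // s sab.
wlog st : s t tab sab / s <= t.
  move=> H; case: (leP s t) => [st|/ltW ts std]; first exact: H.
  by rewrite distrC; apply: H => //; rewrite distrC.
rewrite ler0_norm ?subr_le0// opprB => std; rewrite distrC.
have := dP 1%N (fun=> s) (fun=> t); rewrite !big_ord1; apply=> //.
- by move=> _; split; lra.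
- by move=> i j _ _ _; rewrite !ord1.
Qed.

(** Serves both for [h \o x], controlled by the increments of the curve, and for a function
    corrected by Lipschitz terms, whence the length [v - u] in the bound. *)
Lemma abs_continuous_dominated (V W : normedModType R) a b K
    (F : R -> V) (G : R -> W) :
  (forall u v, a <= u -> u <= v -> v <= b ->
    `|G v - G u| <= K * (`|F v - F u| + (v - u))) ->
  abs_continuous a b F -> abs_continuous a b G.
Proof.
move=> GF acF e e0.
pose C := `|K| + 1.
have C0 : 0 < C by rewrite ltr_wpDl.
have e'0 : 0 < e / (2 * C) by rewrite divr_gt0// mulr_gt0.
have [d d0 dP] := acF _ e'0.
exists (Num.min d (e / (2 * C))) => [|m l r lr tlr]; first by rewrite lt_min d0.
rewrite lt_min => /andP[/(dP m l r lr tlr) sF slr].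
have H : \sum_k `|G (r k) - G (l k)| <=
    C * (\sum_k `|F (r k) - F (l k)| + \sum_k (r k - l k)).
  rewrite -big_split/= mulr_sumr; apply: ler_sum => k _.
  have [? ? ?] := lr k.
  apply: le_trans (GF _ _ _ _ _) _ => //; apply: ler_wpM2r.
    by rewrite addr_ge0// subr_ge0.
  by have := ler_norm K; rewrite /C; lra.
apply: le_lt_trans H _.
rewrite -ltr_pdivlMl//.
have : C^-1 * e = e / (2 * C) + e / (2 * C) by field; rewrite gt_eqF.
lra.
Qed.

End AC.

(** * Gradients, chain rule and Lipschitz bounds *)

Section Grad.
Context {R : realType} {m : nat}.
Implicit Types (h : 'cV[R]_m -> R) (p w : 'cV[R]_m).

Lemma diff_gradient h p w : differentiable h p ->
  'd h p w = (gradient h p *m w) 0 0.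
Proof.
move=> dh; rewrite {1}(matrix_sum_delta w) linear_sum mxE; apply: eq_bigr => j _.
by rewrite big_ord1 linearZ mxE deriveE// mulrC.
Qed.

Lemma is_derive_gradient_comp h (y : R -> 'cV[R]_m) (t : R) w :
  differentiable h (y t) -> is_derive t 1 y w ->
  is_derive t 1 (h \o y) ((gradient h (y t) *m w) 0 0).
Proof.
move=> dh [/derivable1_diffP dy yw].
have dhy : differentiable (h \o y) t by exact: differentiable_comp.
split; first exact/derivable1_diffP.
by rewrite deriveE// diff_comp//= -(deriveE _ dy) yw diff_gradient.
Qed.

(** The norm is the largest absolute value of an entry, hence the factor [m]. *)
Lemma ler_norm_mulmx (A : 'rV[R]_m) w :
  `|(A *m w) 0 0| <= m%:R * `|A| * `|w|.
Proof.
have entry k l (B : 'M[R]_(k, l)) i j : `|B i j| <= `|B|.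
  rewrite [leRHS]/Num.Def.normr/= mx_normrE.
  exact: (le_bigmax _ (fun i : 'I_k * 'I_l => `|B i.1 i.2|) (i, j)).
rewrite mxE (le_trans (ler_norm_sum _ _ _))//.
apply: le_trans (ler_sum _ (G := fun=> `|A| * `|w|) _) _ => [j _|].
  by rewrite normrM ler_pM// entry.
by rewrite sumr_const card_ord -[X in X <= _]mulr_natl mulrA.
Qed.

(** As [S] may fail to be convex, the gradient is bounded on the union [T] of all segments between
    points of [S], compact as a continuous image of S x S x [0, 1]. The mean value theorem along a
    segment then gives the constant. *)
Lemma C1_lipschitz_compact_segments h (S : set 'cV[R]_m) :
  continuously_differentiable h -> compact S ->
  exists2 K : R, 0 <= K & forall p q, S p -> S q -> `|h q - h p| <= K * `|q - p|.
Proof.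
move=> [dh cg] cS.
pose seg (z : 'cV[R]_m * 'cV[R]_m * R) := z.1.1 + z.2 *: (z.1.2 - z.1.1).
pose T := seg @` (S `*` S `*` `[0, 1]).
have cT : compact (gradient h @` T).
  apply: continuous_compact; first exact: continuous_subspaceT.
  apply: continuous_compact; last first.
    by apply: compact_setX; [exact: compact_setX|exact: segment_compact].
  apply: continuous_subspaceT => z; rewrite /seg.
  have c1 : {for z, continuous (fun z : 'cV[R]_m * 'cV[R]_m * R => z.1.1)}.
    by apply: continuous_comp; exact: cvg_fst.
  have c2 : {for z, continuous (fun z : 'cV[R]_m * 'cV[R]_m * R => z.1.2)}.
    by apply: continuous_comp; [exact: cvg_fst|exact: cvg_snd].
  apply: cvgD => //; apply: cvgZ; first exact: cvg_snd.
  exact: cvgB.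
have [B [Br BP]] := compact_bounded cT.
pose C := `|B| + 1.
have BC : B < C by rewrite (le_lt_trans (ler_norm B))// ltrDl.
exists (m%:R * C) => [|p q Sp Sq]; first by rewrite mulr_ge0// addr_ge0.
pose y (s : R) := p + s *: (q - p).
have dy (s : R) : is_derive s 1 y (q - p).
  have [dsc dscE] := is_diff_scalel s (q - p).
  have der : is_derive s 1 (fun s : R => s *: (q - p)) (q - p).
    split; first by apply/derivable1_diffP.
    by rewrite deriveE// dscE scale1r.
  by rewrite -[q - p]add0r; apply: is_deriveD.
have dhy (s : R) := is_derive_gradient_comp (dh (y s)) (dy s).
have [|s] := @MVT R (h \o y) _ 0 1 ltr01 (fun s _ => dhy s).
  apply: continuous_subspaceT => s; apply: differentiable_continuous.
  by apply/derivable1_diffP; have [] := dhy s.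
rewrite in_itv/= subr0 mulr1 {1 2}/y scale0r addr0 scale1r subrKC => s01 ->.
rewrite (le_trans (ler_norm_mulmx _ _))// ler_wpM2r// ler_wpM2l//.
apply: (BP C BC); exists (y s) => //; exists (p, q, s) => //=.
by split=> //=; rewrite in_itv/=; lra.
Qed.

End Grad.

(** * Growth estimates and the barrier argument over one cycle *)

Section Barrier.
Context {R : realType}.
Implicit Types (a b c s t u v p q : R).

(** For [p <= q] and [u <= v], the increment [clamp p q v - clamp p q u] is the length of the part
    of [p, q] inside [u, v]. *)
Definition clamp p q t := Num.max p (Num.min t q).

Lemma clamp_nondecreasing p q u v : u <= v -> clamp p q u <= clamp p q v.
Proof. by move=> uv; rewrite le_max2// le_min2. Qed.

Lemma clamp_lipschitz p q u v : u <= v -> clamp p q v - clamp p q u <= v - u.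
Proof.
rewrite /clamp => uv.
by case: (leP u q) => ?; case: (leP v q) => ?; do 2 ?[case: (leP p _) => ?]; lra.
Qed.

Lemma clamp_itv p q t : p <= q -> p <= clamp p q t <= q.
Proof.
by move=> pq; rewrite /clamp le_max lexx ge_max pq/= ge_min lexx orbT.
Qed.

Lemma clamp_ge p q t : p <= q -> q <= t -> clamp p q t = q.
Proof. by move=> pq qt; rewrite /clamp min_r// max_r. Qed.

(* rho * clamp p q is an antiderivative of rho * 1_[p, q]. *)
Lemma is_derive_clamp p q t : p <= q -> t != p -> t != q ->
  is_derive t 1 (clamp p q) (p <= t <= q)%R%:R.
Proof.
move=> pq tp tq.
have [pt|tp'|E] := ltgtP p t; last by rewrite E eqxx in tp.
  have [qt|tq'|E] := ltgtP t q; last by rewrite E eqxx in tq.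
    apply: (near_eq_is_derive (f := id)).
    near=> s; rewrite /clamp min_l ?max_r//.
      by near: s; exact: lt_le_nbhsr.
    by near: s; exact: lt_le_nbhsl.
  apply: (near_eq_is_derive (f := cst q)).
  by near=> s; rewrite clamp_ge//; near: s; exact: lt_le_nbhsr.
apply: (near_eq_is_derive (f := cst p)).
near=> s; rewrite /clamp max_l// ge_min; apply/orP; left; near: s.
exact: lt_le_nbhsl.
Unshelve. all: by end_near. Qed.

Lemma interval_hull (s e T : R) (J : interval R) : s <= e -> 0 <= T ->
  [set` J] `<=` `[s, e] -> (lebesgue_measure [set` J] <= T%:E)%E ->
  exists z : R * R, [/\ s <= z.1, z.1 <= z.2, z.2 <= e, z.2 - z.1 <= T &
    forall t, t \in J -> z.1 <= t <= z.2].
Proof.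
move=> se T0 Jse muJ.
have [J0|/set0P[x Jx]] := eqVneq [set` J] set0.
  exists (s, s); split => //=; rewrite ?subrr// => t tJ.
  by have : [set` J] t := tJ; rewrite J0.
have := Jse x Jx; rewrite /= in_itv/= => sxe.
move: muJ; rewrite lebesgue_measure_itv.
(* Only bounded intervals survive: an unbounded one is empty or has infinite measure. *)
case: J Jse Jx => [[bl a|[]] [br b|[]]] Jse; rewrite /= ?in_itv/= // ?lte_fin.
- move=> /andP[/lteifW ax /lteifW xb] muJ.
  exists (Num.max a s, Num.min b e) => /=; split.
  + by rewrite le_max lexx orbT.
  + by rewrite ge_max !le_min; lra.
  + by rewrite ge_min lexx orbT.
  + have ? : a <= Num.max a s by rewrite le_max lexx.
    have ? : Num.min b e <= b by rewrite ge_min lexx.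
    suff : b - a <= T by lra.
    move: muJ; case: ltP => [_|ba _]; last lra.
    by rewrite -EFinB lee_fin.
  + move=> t tJ; have := Jse t tJ; rewrite /= in_itv/= => tse.
    move: tJ; rewrite in_itv => /andP[/lteifW ? /lteifW ?].
    by rewrite ge_max le_min; lra.
- by rewrite andbF.
- by rewrite ltry.
- by rewrite ltNyr.
Qed.

Lemma ae_lebesgueS (P Q : R -> Prop) : (forall t, P t -> Q t) ->
  {ae lebesgue_measure, forall t, P t} -> {ae lebesgue_measure, forall t, Q t}.
Proof. by move=> PQ; apply: negligibleS => t /= nQ /PQ. Qed.

Lemma ae_lebesgueS2 (P Q S : R -> Prop) : (forall t, P t -> Q t -> S t) ->
  {ae lebesgue_measure, forall t, P t} -> {ae lebesgue_measure, forall t, Q t} ->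
  {ae lebesgue_measure, forall t, S t}.
Proof.
move=> PQS aeP aeQ; apply: negligibleS (negligibleU aeP aeQ) => t /= nS.
by apply/not_andP => -[/PQS] /[apply].
Qed.

(** Subtracting from [F] an antiderivative of the lower bound leaves an absolutely continuous
    function with almost everywhere nonnegative derivative. *)
Lemma ae_derive_ge_growth a b k n (F : R -> R) (rho p q : 'I_n -> R) :
  a <= b -> (forall i, p i <= q i) -> abs_continuous a b F ->
  {ae lebesgue_measure, forall t, a < t < b -> exists2 d : R,
    k + \sum_i rho i * (p i <= t <= q i)%R%:R <= d & is_derive t 1 F d} ->
  k * (b - a) + \sum_i rho i * (clamp (p i) (q i) b - clamp (p i) (q i) a)
    <= F b - F a.
Proof.
move=> ab pq acF aeF.
pose S := \sum_(i < n) (rho i \*: clamp (p i) (q i)).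
have SE t : S t = \sum_i rho i * clamp (p i) (q i) t by rewrite /S fct_sumE.
pose G := F - (k \*: id) - S.
have GE t : G t = F t - k * t - S t by [].
suff : G a <= G b.
  have -> : \sum_i rho i * (clamp (p i) (q i) b - clamp (p i) (q i) a) = S b - S a.
    by rewrite !SE -sumrB; apply: eq_bigr => i _; rewrite mulrBr.
  rewrite !GE; lra.
apply: abs_continuous_ae_derive_ge0 => //.
  (* The three terms account for [F], for the linear part and for the sum of 1-Lipschitz clamps. *)
  pose K := 1 + `|k| + \sum_i `|rho i|.
  have K1 : 0 <= \sum_i `|rho i| by rewrite sumr_ge0.
  apply: (@abs_continuous_dominated _ _ _ a b K) acF => u v au uv vb.
  have -> : G v - G u = (F v - F u) - k * (v - u) - (S v - S u) by rewrite !GE; ring.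
  have SB : `|S v - S u| <= (\sum_i `|rho i|) * (v - u).
    rewrite !SE -sumrB mulr_suml (le_trans (ler_norm_sum _ _ _))//.
    apply: ler_sum => i _; rewrite -mulrBr normrM ler_wpM2l// ger0_norm.
      exact: clamp_lipschitz.
    by rewrite subr_ge0 clamp_nondecreasing.
  have kB : `|k * (v - u)| = `|k| * (v - u).
    by rewrite normrM [X in _ * X]ger0_norm// subr_ge0.
  have := ler_normB (F v - F u - k * (v - u)) (S v - S u).
  have := ler_normB (F v - F u) (k * (v - u)).
  have : 0 <= (`|k| + \sum_i `|rho i|) * `|F v - F u|.
    by rewrite mulr_ge0// addr_ge0.
  have : K * (`|F v - F u| + (v - u)) = `|F v - F u| + (v - u)
     + (`|k| + \sum_i `|rho i|) * `|F v - F u|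
     + `|k| * (v - u) + (\sum_i `|rho i|) * (v - u) by rewrite /K; ring.
  lra.
(* The finitely many points [p i] and [q i], where the derivative of [clamp] may not be the
   indicator, are discarded. *)
have ae_neq : {ae lebesgue_measure, forall t i, t != p i /\ t != q i}.
  apply: filter_forall => i.
  have neq r : {ae lebesgue_measure, forall t : R, t != r}.
    exists [set r]; split => //; first exact: lebesgue_measure_set1.
    by move=> t /= /negP; rewrite negbK => /eqP.
  by apply: filterI; exact: neq.
apply: ae_lebesgueS2 aeF ae_neq => t aeF neq abt.
have [d dk Fd] := aeF abt.
exists (d - k *: 1 - \sum_i rho i *: (p i <= t <= q i)%R%:R).
  by rewrite /GRing.scale/=; lra.
apply: is_deriveB; apply: is_derive_sum => i.
by apply: is_deriveZ; have [? ?] := neq i; exact: is_derive_clamp.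
Qed.

(** Here [a] and [e] bound one attack cycle, [b] is the start of the next one, and [p i, q i]
    encloses the compromise of subsystem [i]. *)
Lemma barrier_cycle a e b c tau n (F : R -> R) (rho p q : 'I_n -> R) :
  0 < c -> 0 < tau -> a <= e -> tau <= b - e ->
  (forall i, p i <= q i) -> (forall i, q i <= e) -> (forall i, rho i < 0) ->
  0 <= \sum_i rho i * (q i - p i) + c ->
  abs_continuous a b F ->
  {ae lebesgue_measure, forall t, a < t < b -> 0 <= F t < c -> exists2 d : R,
    c / tau + \sum_i rho i * (p i <= t <= q i)%R%:R <= d & is_derive t 1 F d} ->
  c <= F a ->
  c <= F b /\ forall t, a <= t <= b -> 0 < F t.
Proof.
move=> c0 tau0 ae tau_be pq qe rho0 budget acF aeF Fa.
have k0 : 0 < c / tau by rewrite divr_gt0.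
have ab : a <= b by lra.
have excursion s t : a <= s -> s < t -> t <= b -> F s = c ->
    (forall r, s < r -> r < t -> 0 <= F r < c) ->
    c + c / tau * (t - s) +
      \sum_i rho i * (clamp (p i) (q i) t - clamp (p i) (q i) s) <= F t.
  move=> as_ st tb Fs Fr.
  suff : c / tau * (t - s) +
      \sum_i rho i * (clamp (p i) (q i) t - clamp (p i) (q i) s) <= F t - F s.
    by rewrite Fs; lra.
  apply: ae_derive_ge_growth (ltW st) pq _ _.
    exact: abs_continuous_subitv acF.
  apply: ae_lebesgueS aeF => r aeF /andP[sr rt]; apply: aeF; last exact: Fr.
  by rewrite (le_lt_trans as_ sr) (lt_le_trans rt tb).
have cF t : t <= b -> {within `[a, t], continuous F}.
  move=> tb; apply: abs_continuous_within.
  exact: abs_continuous_subitv acF.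
(* Take the first zero [t1] and the last time [s] before it at level [c]. Between them 0 < F < c, so
   the excursion estimate and the budget force [F t1 > 0]. *)
have F_gt0 t : a <= t <= b -> 0 < F t.
  move=> /andP[at_ tb]; rewrite ltNge; apply/negP => Ft.
  have Fa0 : 0 < F a by lra.
  have [t1 [at1 t1t Ft1 before]] := first_le at_ (cF t tb) Fa0 Ft.
  have t1b : t1 <= b by lra.
  have [|s [as_ st1 Fs after]] := last_ge (ltW at1) (cF t1 t1b) Fa; first by rewrite Ft1.
  have := excursion s t1 as_ st1 t1b Fs; rewrite Ft1.
  have : \sum_i rho i * (q i - p i) <=
      \sum_i rho i * (clamp (p i) (q i) t1 - clamp (p i) (q i) s).
    apply: ler_sum => i _; apply: ler_wnM2l; first exact: ltW.
    have := clamp_itv t1 (pq i); have := clamp_itv s (pq i); lra.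
  have : 0 < c / tau * (t1 - s) by rewrite mulr_gt0// subr_gt0.
  move=> kt rhoc; suff inside : forall r, s < r -> r < t1 -> 0 <= F r < c.
    by move=> /(_ inside); lra.
  move=> r sr rt1; rewrite (after r sr (ltW rt1)) andbT ltW// before//; lra.
split => //; rewrite leNgt; apply/negP => Fb.
have [s [as_ sb Fs after]] := last_ge ab (cF b (lexx b)) Fa Fb.
have := excursion s b as_ sb (lexx b) Fs.
have inside r : s < r -> r < b -> 0 <= F r < c.
  by move=> sr rb; rewrite (after r sr (ltW rb)) andbT ltW// F_gt0//; lra.
move=> /(_ inside).
have clampb i : clamp (p i) (q i) b = q i by apply: clamp_ge => //; have := qe i; lra.
(* If [s <= e], the recovery term over [s, b] is at least [c] and the budget absorbs the attacks;
   otherwise every clamp is already saturated at [q i] and the attacks contribute nothing. *)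
have [se|es] := leP s e.
  have : \sum_i rho i * (q i - p i) <=
      \sum_i rho i * (clamp (p i) (q i) b - clamp (p i) (q i) s).
    apply: ler_sum => i _; apply: ler_wnM2l; first exact: ltW.
    by have := clamp_itv s (pq i); rewrite clampb; lra.
  have : c / tau * tau <= c / tau * (b - s) by apply: ler_wpM2l; [exact: ltW|lra].
  rewrite divfK ?gt_eqF//; lra.
rewrite big1 => [|i _]; last first.
  by rewrite clampb clamp_ge ?subrr ?mulr0//; have := qe i; lra.
have : 0 < c / tau * (b - s) by rewrite mulr_gt0// subr_gt0.
lra.
Qed.

End Barrier.

(** * Stacked states and the closed-loop system *)

Lemma is_derive_mxcol (R : realType) (N : nat) (n : 'I_N -> nat)
    (x : R -> 'cV[R]_(\sum_i n i)) (t : R) (w : forall i, 'cV[R]_(n i)) :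
  (forall i, is_derive t 1 (fun s => submxcol (x s) i) (w i)) ->
  is_derive t 1 x (\mxcol_i w i).
Proof.
move=> xw.
have xE k j : (fun s => x s k j) =
    (fun s => submxcol (x s) (tagnat.sig1 k) (tagnat.sig2 k) j).
  by apply/funext => s; rewrite -{1}(submxcolK (x s)) mxE.
have dx : derivable x t 1.
  apply/derivable_mxP => k j; rewrite xE.
  by have [/derivable_mxP + _] := xw (tagnat.sig1 k); apply.
split => //; rewrite derive_mx//; apply/matrixP => k j; rewrite !mxE xE.
by have [dxi <-] := xw (tagnat.sig1 k); rewrite derive_mx// mxE.
Qed.

Lemma gradient_mxcol (R : realType) (N : nat) (n : 'I_N -> nat)
    (h : 'cV[R]_(\sum_i n i) -> R) y (w : forall i, 'cV[R]_(n i)) :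
  (gradient h y *m \mxcol_i w i) 0 0 = \sum_i (partial_block h y i *m w i) 0 0.
Proof. by rewrite -[gradient h y]submxrowK mul_mxrow_mxcol summxE. Qed.

Theorem theorem2 (R : realType) (N : nat) (n r : 'I_N -> nat)
  (* dynamics and input sets *)
  (f : forall i, 'cV[R]_(\sum_j n j) -> 'cV[R]_(n i))
  (g : forall i, 'cV[R]_(\sum_j n j) -> 'M[R]_(n i, r i))
  (ulo uhi : forall i, 'cV[R]_(r i))
  (f_lip : forall i, lipschitz (f i))
  (g_lip : forall i, lipschitz (g i))
  (ulo_uhi : forall i j, ulo i j 0 < uhi i j 0)
  (* safety function, margin and nominal policy *)
  (h : 'cV[R]_(\sum_j n j) -> R)
  (h_C1 : continuously_differentiable h)
  (c tau : R) (c_gt0 : 0 < c) (tau_gt0 : 0 < tau)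
  (alpha : R -> R) (alpha_K : extended_class_K alpha)
  (mu : forall i, 'cV[R]_(\sum_j n j) -> 'cV[R]_(r i))
  (mu_box : forall i x, input_box ulo uhi i (mu i x))
  (mu_nominal : nominal_policy_assumption f g h mu alpha c tau)
  (* resilient architectures, their recovery times, and the assignment *)
  (A : finType) (trec : A -> R) (trec_ge0 : forall a, 0 <= trec a)
  (M : 'I_N -> A)
  (* recovery budget *)
  (rho : 'I_N -> R) (rho_lt0 : forall i, rho i < 0)
  (rho_bound : forall i x v,
     (safe_set h `\` superlevel h c) x -> input_box ulo uhi i v ->
     rho i <= (partial_block h x i *m (g i x *m (v - mu i x))) 0 0)
  (budget : 0 <= \sum_i rho i * trec (M i) + c)
  (* attack cycles *)
  (t0 : R) (ts tf : nat -> R) (I : nat -> 'I_N -> interval R)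
  (ts0 : ts 0%N = t0)
  (attack : attack_schedule (fun i => trec (M i)) ts tf I)
  (gap : forall k, tau <= ts k.+1 - tf k)
  (* closed-loop trajectory *)
  (x : R -> 'cV[R]_(\sum_j n j)) (u : forall i, R -> 'cV[R]_(r i))
  (x_traj : trajectory f g ulo uhi t0 x u)
  (u_nominal : forall i t, t0 <= t -> ~ compromised I i t ->
     u i t = mu i (x t))
  (x_init : superlevel h c (x t0)) :
  forall t, t0 <= t -> safe_set h (x t).
Proof.
have [mu_c mu_in] := mu_nominal.
have [tsf I_cycle I_trec] := attack.
have [_ u_box x_ac x_der] := x_traj.
have ts_step k : ts k + tau <= ts k.+1 by have := gap k; have := tsf k; lra.
have ts_mono : {homo ts : j k / (j <= k)%N >-> j <= k}.
  by apply: homo_leq => [//|? ? ?|k]; [exact: le_trans|have := ts_step k; lra].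
(* Cycle starts grow at least linearly, so they cannot accumulate and they exhaust the half-line. *)
have ts_lb k : t0 + tau * k%:R <= ts k.
  elim: k => [|k IH]; first by rewrite ts0 mulr0 addr0.
  by rewrite -natr1 mulrDr mulr1; have := ts_step k; lra.
have t0_ts k : t0 <= ts k by rewrite -ts0 ts_mono.
(* Each compromise interval is replaced by a closed one inside its cycle, of length at most the
   recovery time. *)
have /choice[spike spikeP] (ki : nat * 'I_N) := interval_hull (tsf ki.1)
  (trec_ge0 (M ki.2)) (I_cycle ki.1 ki.2) (I_trec ki.1 ki.2).
pose p k i := (spike (k, i)).1; pose q k i := (spike (k, i)).2.
have hx_ac b : t0 <= b -> abs_continuous t0 b (h \o x).
  move=> t0b.
  have cS : compact (x @` `[t0, b]).
    apply: continuous_compact; last exact: segment_compact.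
    exact/abs_continuous_within/x_ac.
  have [K K0 Kh] := C1_lipschitz_compact_segments h_C1 cS.
  apply: (@abs_continuous_dominated _ _ _ t0 b K x) (x_ac b t0b) => s t t0s st tb.
  apply: le_trans (Kh _ _ _ _) _.
  - by exists s => //=; rewrite in_itv/=; lra.
  - by exists t => //=; rewrite in_itv/=; lra.
  - by rewrite ler_wpM2l// lerDl subr_ge0.
(* Earlier cycles end before [ts k] and later ones start no sooner than [ts k.+1], so the attack
   belongs to cycle [k]. *)
have compromised_cycle k i t : ts k < t < ts k.+1 ->
    compromised I i t -> p k i <= t <= q k i.
  move=> /andP[kt tk] [j tj].
  have := I_cycle j i t tj; rewrite /= in_itv/= => /andP[jt tf_t].
  have [jk|kj|jk] := ltngtP j k.
  - by have := ts_mono _ _ jk; have := gap j; lra.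
  - by have := ts_mono _ _ kj; lra.
  - by rewrite jk in tj; have [_ _ _ _] := spikeP (k, i); apply.
have hx_der k : {ae lebesgue_measure, forall t, ts k < t < ts k.+1 ->
    0 <= (h \o x) t < c -> exists2 d : R,
    c / tau + \sum_i rho i * (p k i <= t <= q k i)%R%:R <= d &
    is_derive t 1 (h \o x) d}.
  apply: ae_lebesgueS x_der => t x_der /[dup] ktk /andP[kt tk] /andP[h0 hc].
  have t0t : t0 < t by apply: le_lt_trans kt.
  have xt_in : (safe_set h `\` superlevel h c) (x t).
    by split => //; apply/negP; rewrite -ltNge.
  exists (\sum_i (partial_block h (x t) i *m (f i (x t) + g i (x t) *m u i t)) 0 0).
    apply: le_trans (lerD (mu_in _ xt_in) (lexx _)) _.
    rewrite /nominal_hdot -big_split/=; apply: ler_sum => i _.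
    have -> : f i (x t) + g i (x t) *m u i t = f i (x t) + g i (x t) *m mu i (x t)
        + g i (x t) *m (u i t - mu i (x t)).
      by rewrite mulmxBr -addrA subrKC.
    rewrite [in leRHS]mulmxDr [in leRHS]mxE lerD2l.
    have [it|nit] := pselect (compromised I i t).
      rewrite (compromised_cycle k)// mulr1; apply: rho_bound => //.
      exact/u_box/ltW.
    (* The enclosing interval may contain [t] although [i] is not compromised; the deviation is then
       0, still above the nonpositive bound. *)
    rewrite (u_nominal _ _ (ltW t0t) nit) subrr !mulmx0 mxE.
    by apply: mulr_le0_ge0; [exact: ltW|exact: ler0n].
  rewrite -gradient_mxcol; apply: is_derive_gradient_comp; first exact: h_C1.1.
  by apply: is_derive_mxcol => i; exact: x_der.
have cycle k : c <= h (x (ts k)) ->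
    c <= h (x (ts k.+1)) /\ forall t, ts k <= t <= ts k.+1 -> 0 < h (x t).
  move=> hk; apply: (barrier_cycle (F := h \o x) (tau := tau) (e := tf k)
    (rho := rho) (p := p k) (q := q k) c_gt0 tau_gt0 (tsf k) (gap k)) => //.
  - by move=> i; have [] := spikeP (k, i).
  - by move=> i; have [] := spikeP (k, i).
  (* Shorter intervals only help, as each [rho i] is negative. *)
  - apply: le_trans budget _; rewrite lerD2r; apply: ler_sum => i _.
    by apply: ler_wnM2l; [exact: ltW|have [] := spikeP (k, i)].
  - exact: abs_continuous_subitv (t0_ts k) (lexx _) (hx_ac _ (t0_ts _)).
have h_ts k : c <= h (x (ts k)).
  elim: k => [|k /cycle[]//]; by rewrite ts0.
have safe_until k t : t0 <= t <= ts k -> 0 <= h (x t).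
  elim: k => [|k IH] /andP[t0t tk].
    have -> : t = t0 by apply/eqP; rewrite eq_le t0t -ts0 tk.
    exact: le_trans (ltW c_gt0) x_init.
  have [tk'|kt] := leP t (ts k); first by rewrite IH// t0t.
  by apply/ltW/(cycle k (h_ts k)).2; rewrite ltW.
(* This [k] exceeds (t - t0) / tau, so [ts k] lies beyond [t]. *)
move=> t t0t; pose k := (Num.truncn ((t - t0) / tau)).+1.
apply: (safe_until k); rewrite t0t/=; apply: le_trans (ts_lb k).
have : (t - t0) / tau < k%:R by apply: truncnS_gt.
by rewrite ltr_pdivrMr// mulrC; lra.
Qed.
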